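(* Choose a compact interval $K\subset(0,1)$ and assume that $U^*:K\to\ell^\infty(\Lambda)$, $\mu\mapsto U^*(\mu)$, is a smooth function so that $\mathcal{F}(U^*(\mu),\mu)=0$ for all $\mu\in K$. There exist $d_0>0$ and a unique function $\tilde U:(-d_0,d_0)\times K\to\ell^\infty(\Lambda)$ so that $\tilde U(d,\mu)$ is smooth, it is a stationary solution of $$\dot U=dLU+\mathcal{F}(U,\mu),\qquad U=(U_\lambda)_{\lambda\in\Lambda}\in\ell^\infty(\Lambda),$$ for all $d\in(-d_0,d_0)$ and $\mu\in K$, and it satisfies $\tilde U(0,\mu)=U^*(\mu)$ for each $\mu\in K$.
   Context: $\Lambda\subset\mathbb{R}^n$ is an arbitrary discrete set used as an index set, $\ell^\infty(\Lambda)$ is the Banach space of bounded real-valued functions on $\Lambda$, and $\mathcal{F}:\ell^\infty(\Lambda)\times\mathbb{R}\to\ell^\infty(\Lambda)$ is given by $[\mathcal{F}(U,\mu)]_\lambda=-\mu U_\lambda+2U_\lambda^3-U_\lambda^5$ for $\lambda\in\Lambda$. $L:\ell^\infty(\Lambda)\to\ell^\infty(\Lambda)$ is any bounded linear operator, and $d,\mu\in\mathbb{R}$ are parameters. *)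

(* Defs.v *)
From HB Require Import structures.
From mathcomp Require Import all_boot all_order all_algebra.
From mathcomp Require Import all_classical all_reals all_analysis.

Set Implicit Arguments.
Unset Strict Implicit.
Unset Printing Implicit Defensive.

Import Order.TTheory GRing.Theory Num.Theory.
Import numFieldNormedType.Exports.

Local Open Scope classical_set_scope.
Local Open Scope ring_scope.

Section linf.
Context {R : realType} {T : Type}.

Definition bounded_pred : {pred T -> R} :=
  [pred f : T -> R | `[< bounded_fun f >]].

Record linf : Type := Linf {
  linf_fun :> T -> R;
  linf_fun_bounded : linf_fun \in bounded_pred }.

HB.instance Definition _ := [isSub for linf_fun].
HB.instance Definition _ := gen_eqMixin linf.
HB.instance Definition _ := gen_choiceMixin linf.

Lemma bounded_predP (f : T -> R) :
  reflect (exists M : R, forall t, `|f t| <= M) (f \in bounded_pred).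
Proof.
apply: (iffP idP) => [/asboolP/pinfty_ex_gt0[M _ fM]|[M fM]].
  by exists M => t; exact: fM.
apply/asboolP; exists M; split=> [|N /ltW MN t _ /=]; first exact: num_real.
exact: le_trans (fM t) MN.
Qed.

Lemma bounded_pred_submod_closed : submod_closed bounded_pred.
Proof.
split; first by apply/bounded_predP; exists 0 => t; rewrite normr0.
move=> a f g /bounded_predP[M fM] /bounded_predP[N gN].
apply/bounded_predP; exists (`|a| * M + N) => t.
by rewrite (le_trans (ler_normD _ _))// lerD// normrM ler_wpM2l.
Qed.

HB.instance Definition _ := GRing.isSubmodClosed.Build _ _ bounded_pred
  bounded_pred_submod_closed.
HB.instance Definition _ := [SubChoice_isSubLmodule of linf by <:].

Lemma linfP (f g : linf) : (forall t, f t = g t) -> f = g.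
Proof. by move=> fg; apply: val_inj; apply/funext. Qed.

Lemma linf_bounded (f : linf) : exists M : R, forall t, `|f t| <= M.
Proof. exact/bounded_predP/linf_fun_bounded. Qed.

(* When [T] is empty this is [sup set0 = 0]. *)
Definition linf_norm (f : linf) : R := sup (range (fun t => `|f t|)).

Lemma le_linf_norm (f : linf) t : `|f t| <= linf_norm f.
Proof.
apply: ub_le_sup; last by exists t.
by have [M fM] := linf_bounded f; exists M => _ [s _ <-].
Qed.

Lemma linf_norm_ge0 (f : linf) : 0 <= linf_norm f.
Proof.
have [[t _]|T0] := pselect (exists t : T, True).
  exact: le_trans (normr_ge0 _) (le_linf_norm f t).
rewrite /linf_norm; suff -> : range (fun t => `|f t|) = set0 by rewrite sup0.
by apply/seteqP; split => // x [t _ _]; apply: T0; exists t.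
Qed.

Lemma linf_norm_le (f : linf) M :
  0 <= M -> (forall t, `|f t| <= M) -> linf_norm f <= M.
Proof.
move=> M0 fM; have [[t _]|T0] := pselect (exists t : T, True).
  by apply: ge_sup; [exists `|f t|, t | move=> _ [s _ <-]].
rewrite /linf_norm; suff -> : range (fun t => `|f t|) = set0 by rewrite sup0.
by apply/seteqP; split => // x [t _ _]; apply: T0; exists t.
Qed.

Lemma linf_normD (f g : linf) :
  linf_norm (f + g) <= linf_norm f + linf_norm g.
Proof.
apply: linf_norm_le => [|t]; first by rewrite addr_ge0// linf_norm_ge0.
by rewrite (le_trans (ler_normD _ _))// lerD// le_linf_norm.
Qed.

Lemma linf_normZ (a : R) (f : linf) :
  linf_norm (a *: f) = `|a| * linf_norm f.
Proof.
have le_normZ b (g : linf) : linf_norm (b *: g) <= `|b| * linf_norm g.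
  apply: linf_norm_le => [|t]; first by rewrite mulr_ge0// linf_norm_ge0.
  by rewrite normrM ler_wpM2l// le_linf_norm.
apply/eqP; rewrite eq_le le_normZ/=.
have [->|a0] := eqVneq a 0; first by rewrite normr0 mul0r linf_norm_ge0.
rewrite -ler_pdivlMl ?normr_gt0// -normfV.
by rewrite (le_trans _ (le_normZ _ _))// scalerA mulVf// scale1r.
Qed.

Lemma linf_norm0_eq0 (f : linf) : linf_norm f = 0 -> f = 0.
Proof.
move=> f0; apply: linfP => t; apply/eqP; rewrite -normr_le0 -f0.
exact: le_linf_norm.
Qed.

HB.instance Definition _ := @Lmodule_isNormed.Build R linf
  linf_norm linf_normD linf_normZ linf_norm0_eq0.

Lemma linf_normE (f : linf) : `|f| = sup (range (fun t => `|f t|)).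
Proof. by []. Qed.

Lemma linf_complete (F : set_system linf) : ProperFilter F ->
  cauchy F -> cvg F.
Proof.
move=> FF /cauchy_ballP Fc.
have ltN (f g : linf) t e : ball f e g -> `|f t - g t| < e.
  by rewrite -ball_normE /=; apply: le_lt_trans; exact: (le_linf_norm (f - g)).
have cvF t : cvg ((fun f : linf => f t) @ F).
  apply: cauchy_cvg; apply: cauchy_exP => e e0.
  near F => f; exists (f t).
  suff fe : F [set g : linf | `|f t - g t| < e] by rewrite -ball_normE.
  near=> g; apply: ltN; near: g; near: f; exact: nearP_dep (Fc _ e0).
pose l t := lim ((fun f : linf => f t) @ F).
have close e : 0 < e -> F [set f : linf | forall t, `|f t - l t| <= e].
  move=> e0; have e20 : 0 < e / 2 by rewrite divr_gt0.
  have /nearP_dep Fc' := Fc _ e20.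
  near=> f => t; near F => g.
  have -> : f t - l t = (f t - g t) - (l t - g t).
    by rewrite opprB addrA subrK.
  rewrite (le_trans (ler_normB _ _))// [e]splitr lerD//.
    by apply/ltW/ltN; near: g; near: f.
  by near: g; apply: cvgr_dist_le e20; exact: cvF.
have lb : l \in bounded_pred.
  near F => f; have [M fM] := linf_bounded f.
  apply/bounded_predP; exists (M + 1) => t.
  have -> : l t = f t - (f t - l t) by rewrite opprB addrC subrK.
  rewrite (le_trans (ler_normB _ _))// lerD//.
  by move: t; near: f; exact: close.
apply/cvg_ex; exists (Linf lb); apply/cvgrPdist_le => e e0.
near=> f; apply: linf_norm_le; first exact: ltW.
by move=> t; rewrite distrC; move: t; near: f; exact: close.
Unshelve. all: by end_near. Qed.

HB.instance Definition _ := Uniform_isComplete.Build linf linf_complete.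

End linf.
Arguments linf R T : clear implicits.

Section nonlinearity.
Context {R : realType} {T : Type}.
Implicit Types (U : linf R T) (mu : R).

Lemma nonlinearity_bounded U mu :
  (fun t => - mu * U t + 2 * U t ^+ 3 - U t ^+ 5) \in bounded_pred.
Proof.
have [M UM] := linf_bounded U; apply/bounded_predP.
exists (`|mu| * M + 2 * M ^+ 3 + M ^+ 5) => t.
have UX k : `|U t| ^+ k <= M ^+ k.
  by rewrite lerXn2r// nnegrE (le_trans (normr_ge0 (U t))).
have le3 (x y z : R) : `|x + y - z| <= `|x| + `|y| + `|z|.
  by apply: le_trans (ler_normB _ _) _; rewrite lerD2r ler_normD.
apply: le_trans (le3 _ _ _) _.
rewrite normrX 2!normrM normrX normrN (ger0_norm (ler0n _ _)).
by apply: lerD => //; apply: lerD; apply: ler_wpM2l.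
Qed.

Definition nonlinearity U mu : linf R T := Linf (nonlinearity_bounded U mu).

End nonlinearity.

Section smooth.
Context {R : realType} {V W : normedModType R}.
Implicit Types (f : V -> W) (A : set V).

Definition iter_derive (vs : seq V) f : V -> W :=
  foldr (fun v g => 'D_v g) f vs.

(* All iterated directional derivatives exist and are differentiable (hence
   continuous): for finite-dimensional [V] this is C^oo on the open set. *)
Definition smooth_on_open (O : set V) f :=
  forall vs x, O x -> differentiable (iter_derive vs f) x.

(* On an arbitrary set, smoothness means having a smooth extension to an open
   neighborhood; only the values of [f] on [A] matter. *)
Definition smooth_on A f := exists (O : set V) (g : V -> W),
  [/\ open O, A `<=` O, smooth_on_open O g & forall x, A x -> g x = f x].

End smooth.

Section ode.
Context {R : realType} {V : normedModType R}.

Definition ode_solution (G : V -> V) (u : R -> V) :=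
  forall t : R, is_derive t 1 u (G (u t)).

Definition stationary_solution (G : V -> V) (x : V) := ode_solution G (cst x).

End ode.

(* Main.v *)
Require Import Defs.
From HB Require Import structures.
From mathcomp Require Import all_boot all_order all_algebra.
From mathcomp Require Import all_classical all_reals all_analysis.
From mathcomp Require Import ring lra.

Import Order.TTheory GRing.Theory Num.Theory.
Import numFieldNormedType.Exports.

Set Implicit Arguments.
Unset Strict Implicit.
Unset Printing Implicit Defensive.

Local Open Scope classical_set_scope.
Local Open Scope ring_scope.

(** The statement is an implicit function theorem at the points (0, mu), uniform
    in mu, in the Banach space of bounded functions; the equation is
    residual (d, mu) U = d L U + F(U, mu) = 0.

    Pointwise, a zero u of F(., mu) satisfies u = 0 or (1 - u^2)^2 = 1 - mu, so
    for mu in [a, b] it is bounded by 2 and the derivative of F(., mu) at u is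
    at least a (1 - b) in absolute value ([root_bounds]). Multiplication by this
    derivative at U*(mu) is therefore invertible with a uniform bound. Since F
    acts pointwise, a difference of residuals is exactly
    residual x u - residual x v = A (u - v), where A is multiplication by a
    divided difference of F plus d L ([residualB]); near U*(mu) and for small d
    this A is a small perturbation of the multiplication above
    ([linop_close]). Hence A is bijective with uniformly bounded inverse
    ([linop_expands], [linop_surjective]), and a simplified Newton iteration
    gives exactly one zero in a ball of fixed radius around U*(mu)
    ([newton_zero], [residual_inj]).

    A smooth branch must live on a neighbourhood of (-d0, d0) x [a, b]. For mu
    slightly outside [a, b] the iteration starts at U*(clamp mu), the value of
    U* at the nearest point of [a, b]: the error that this causes in F is
    (mu - clamp mu) U*(clamp mu), which is small uniformly in mu.

    Smoothness is proved without higher differentials. The class [branch_alg] is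
    the set of maps generated by the branch U under linear combinations,
    pointwise products, L, and inversion of the linearised operator along U.
    Implicit differentiation shows that a map in this class is differentiable
    with both partial derivatives again in the class ([alg_grad]); so all
    iterated directional derivatives exist and are differentiable. The
    differentiability of U and that of an inverse A^-1 f both follow from
    [has_grad_implicit].

    For global uniqueness, a competing branch V starts at U*(mu) when d = 0 and
    is continuous in d. Wherever it is within the radius r of U*(mu) it equals U
    and so is within r / 2; by the intermediate value theorem it never leaves
    the ball ([trapped_along_segment]). *)

(** * Maps of two real variables and their gradients *)

Lemma frechet_is_diff {R : realType} {V W : normedModType R} (f : V -> W)
    (df : {linear V -> W}) (x : V) : continuous df ->
  (forall e, 0 < e -> \forall y \near x,
     `|f y - f x - df (y - x)| <= e * `|y - x|) ->
  is_diff x f df.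
Proof.
move=> dfc fx.
have fE : f \o shift x = cst (f x) + df +o_ 0 id.
  apply/eqaddoP => e e0.
  have := fx e e0; rewrite (near_shift 0 x) subr0 => fxe.
  near=> h.
  have : `|f (h + x) - f x - df (h + x - x)| <= e * `|h + x - x|.
    by near: h; exact: fxe.
  by rewrite addrK opprD addrA.
have dE := diff_unique dfc fE.
by apply: DiffDef => //; apply/diff_locallyP; rewrite dE.
Unshelve. all: by end_near. Qed.

Section gradient.
Context {R : realType} {E : normedModType R}.
Implicit Types (f g : R * R -> E) (x y : R * R) (u v w : E).

(** Frechet differentiability, with partial derivatives [u] and [v], in the
    epsilon form in which the estimates below produce it. *)
Definition has_grad f x u v := forall e, 0 < e -> \forall y \near x,
  `|f y - f x - ((y.1 - x.1) *: u + (y.2 - x.2) *: v)| <= e * `|y - x|.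

Lemma normr_fst x y : `|y.1 - x.1| <= `|y - x|.
Proof. by rewrite [`|y - x|]prod_normE le_max lexx. Qed.

Lemma normr_snd x y : `|y.2 - x.2| <= `|y - x|.
Proof. by rewrite [`|y - x|]prod_normE le_max lexx orbT. Qed.

Definition comb2 u v (h : R * R) : E := h.1 *: u + h.2 *: v.

Lemma comb2_linear u v : linear (comb2 u v).
Proof.
move=> k h h'; rewrite /comb2 /= !scalerDl !scalerDr !scalerA.
exact: addrACA.
Qed.

HB.instance Definition _ u v :=
  GRing.isLinear.Build R (R * R)%type E _ (comb2 u v) (comb2_linear u v).

Lemma comb2_le u v (h : R * R) : `|comb2 u v h| <= (`|u| + `|v|) * `|h|.
Proof.
rewrite (le_trans (ler_normD _ _))// !normrZ mulrDl.
have := normr_fst 0 h; have := normr_snd 0 h; rewrite !subr0 => h2 h1.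
by rewrite lerD// mulrC ler_wpM2l.
Qed.

Lemma comb2_continuous u v : continuous (comb2 u v).
Proof.
apply: bounded_linear_continuous; apply/linear_boundedP.
near=> k => h; rewrite (le_trans (comb2_le u v h))// ler_wpM2r//.
Unshelve. all: by end_near. Qed.

Lemma has_grad_is_diff f x u v : has_grad f x u v -> is_diff x f (comb2 u v).
Proof.
move=> fx; apply: (@frechet_is_diff _ _ _ _ (comb2 u v)) => [|e e0].
  exact: comb2_continuous.
exact: fx.
Qed.

Lemma has_grad_differentiable f x u v : has_grad f x u v -> differentiable f x.
Proof. by move=> /has_grad_is_diff[]. Qed.

Lemma has_grad_derive f x u v h :
  has_grad f x u v -> 'D_h f x = h.1 *: u + h.2 *: v.
Proof. by move=> /has_grad_is_diff[fx fE]; rewrite deriveE// fE. Qed.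

End gradient.

Section gradient_rules.
Context {R : realType} {E : normedModType R}.
Implicit Types (f g k : R * R -> E) (x y : R * R) (u v : E).

Lemma has_grad_lipschitz f x u v : has_grad f x u v ->
  \forall y \near x, `|f y - f x| <= (`|u| + `|v| + 1) * `|y - x|.
Proof.
move=> /(_ 1 ltr01); apply: filterS => y fy.
rewrite -[f y - f x](subrK ((y.1 - x.1) *: u + (y.2 - x.2) *: v)).
rewrite (le_trans (ler_normD _ _))// addrC mulrDl lerD//.
exact: (comb2_le u v (y - x)).
Qed.

Lemma near_dist_le x (e : R) : 0 < e -> \forall y \near x, `|y - x| <= e.
Proof.
by move=> e0; near=> y; rewrite distrC; near: y; apply: cvgr_dist_le.
Unshelve. all: by end_near. Qed.

Lemma has_grad_dist_le f x u v : has_grad f x u v ->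
  forall e, 0 < e -> \forall y \near x, `|f y - f x| <= e.
Proof.
move=> fx e e0; have N0 : 0 < `|u| + `|v| + 1 by rewrite ltr_wpDl// addr_ge0.
near=> y; have fy : `|f y - f x| <= (`|u| + `|v| + 1) * `|y - x|.
  by near: y; exact: has_grad_lipschitz fx.
rewrite (le_trans fy)// mulrC -ler_pdivlMr//.
by near: y; apply: near_dist_le; rewrite divr_gt0.
Unshelve. all: by end_near. Qed.

Lemma near_eq_has_grad f g x u v : (\forall y \near x, f y = g y) ->
  has_grad g x u v -> has_grad f x u v.
Proof.
move=> fg gx e e0; near=> y.
have -> : f y = g y by near: y.
by rewrite (nbhs_singleton fg); near: y; exact: gx.
Unshelve. all: by end_near. Qed.

Lemma has_grad_cst (a : E) x : has_grad (fun=> a) x 0 0.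
Proof.
move=> e e0; near=> y.
by rewrite !scaler0 addr0 !subrr normr0 mulr_ge0// ltW.
Unshelve. all: by end_near. Qed.

Lemma has_grad_comb2 u v x : has_grad (fun y => y.1 *: u + y.2 *: v) x u v.
Proof.
move=> e e0; near=> y.
rewrite !scalerBl [X in X - _](_ : _ = y.1 *: u - x.1 *: u + (y.2 *: v - x.2 *: v)).
  by rewrite subrr normr0 mulr_ge0// ltW.
by rewrite opprD addrACA.
Unshelve. all: by end_near. Qed.

Lemma has_grad_add f g x u v u' v' : has_grad f x u v -> has_grad g x u' v' ->
  has_grad (fun y => f y + g y) x (u + u') (v + v').
Proof.
move=> fx gx e e0; have e2 : 0 < e / 2 by rewrite divr_gt0.
near=> y.
have fy : `|f y - f x - ((y.1 - x.1) *: u + (y.2 - x.2) *: v)| <= e / 2 * `|y - x|.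
  by near: y; exact: fx.
have gy : `|g y - g x - ((y.1 - x.1) *: u' + (y.2 - x.2) *: v')| <= e / 2 * `|y - x|.
  by near: y; exact: gx.
rewrite [X in `|X|](_ : _ =
  (f y - f x - ((y.1 - x.1) *: u + (y.2 - x.2) *: v)) +
  (g y - g x - ((y.1 - x.1) *: u' + (y.2 - x.2) *: v'))); last first.
  rewrite !scalerDr (addrACA (_ *: u)) (opprD (f x)) (addrACA (f y)).
  by rewrite (opprD (_ *: u + _ *: v)) (addrACA (f y - f x)).
by rewrite (le_trans (ler_normD _ _))// [e]splitr mulrDl lerD.
Unshelve. all: by end_near. Qed.

Lemma has_grad_linear (B : {linear E -> E}) (M : R) f x u v :
  0 < M -> (forall a, `|B a| <= M * `|a|) -> has_grad f x u v ->
  has_grad (fun y => B (f y)) x (B u) (B v).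
Proof.
move=> M0 BM fx e e0.
near=> y.
have fy : `|f y - f x - ((y.1 - x.1) *: u + (y.2 - x.2) *: v)|
    <= e / M * `|y - x|.
  by near: y; apply: fx; rewrite divr_gt0.
rewrite -!linearZ/= -linearD -!linearB/= (le_trans (BM _))//.
rewrite (le_trans (ler_wpM2l (ltW M0) fy))//.
by rewrite mulrA mulrCA mulfV ?gt_eqF// mulr1.
Unshelve. all: by end_near. Qed.

Lemma has_grad_scale (a : R) f x u v : has_grad f x u v ->
  has_grad (fun y => a *: f y) x (a *: u) (a *: v).
Proof.
apply: (@has_grad_linear ( *:%R a) (`|a| + 1)) => [|b].
  by rewrite ltr_wpDl.
by rewrite normrZ ler_wpM2r// lerDl.
Qed.

(** The common core of implicit differentiation and of the differentiation of an
    inverse operator: the error is measured against the increment of the unknown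
    [w] itself. The lower bound on [A] first controls the increment of [w] by that of [k], so
    the error is little-o of the variable; applied to the linearisation error it
    then gives the gradient. *)
Lemma has_grad_implicit (A : {linear E -> E}) (C : R) k (w : R * R -> E) x (w1 w2 : E) :
  0 < C -> (forall a, `|a| <= C * `|A a|) ->
  has_grad k x (A w1) (A w2) ->
  (forall e, 0 < e -> \forall y \near x,
     `|A (w y - w x) - (k y - k x)| <= e * `|w y - w x|) ->
  has_grad w x w1 w2.
Proof.
move=> C0 AC kx wk e e0.
pose N := `|A w1| + `|A w2| + 1.
have N0 : 0 < N by rewrite ltr_wpDl// addr_ge0.
have lipw : \forall y \near x, `|w y - w x| <= 2 * C * N * `|y - x|.
  near=> y.
  have ky : `|k y - k x| <= N * `|y - x|.
    by near: y; exact: has_grad_lipschitz kx.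
  have wy : `|A (w y - w x) - (k y - k x)| <= (2 * C)^-1 * `|w y - w x|.
    by near: y; apply: wk; rewrite invr_gt0 mulr_gt0.
  have Aw : `|A (w y - w x)| <= (2 * C)^-1 * `|w y - w x| + N * `|y - x|.
    rewrite -[A _](subrK (k y - k x)).
    by rewrite (le_trans (ler_normD _ _))// lerD.
  have := le_trans (AC (w y - w x)) (ler_wpM2l (ltW C0) Aw).
  have -> : C * ((2 * C)^-1 * `|w y - w x| + N * `|y - x|) =
    2^-1 * `|w y - w x| + C * N * `|y - x|.
    by field; rewrite gt_eqF.
  by lra.
near=> y.
have wy1 : `|w y - w x| <= 2 * C * N * `|y - x| by near: y.
have wy2 : `|A (w y - w x) - (k y - k x)| <= e / (4 * C * C * N) * `|w y - w x|.
  by near: y; apply: wk; rewrite divr_gt0// !mulr_gt0.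
have ky : `|k y - k x - ((y.1 - x.1) *: A w1 + (y.2 - x.2) *: A w2)|
    <= e / (2 * C) * `|y - x|.
  by near: y; apply: kx; rewrite divr_gt0// mulr_gt0.
rewrite (le_trans (AC _))// linearB (linearD _ (_ *: w1)) !linearZ/=.
rewrite -[A (w y - w x)](subrK (k y - k x)) -addrA.
apply: (@le_trans _ _ (C * (e / (4 * C * C * N) * (2 * C * N * `|y - x|) +
   e / (2 * C) * `|y - x|))).
  (* 2 C N is the Lipschitz constant of [w] at [x]; the two halves of e add up
     after multiplication by C. *)
  rewrite ler_wpM2l ?(ltW C0)// (le_trans (ler_normD _ _))// lerD//.
  by rewrite (le_trans wy2)// ler_wpM2l// divr_ge0 ?ltW// !mulr_gt0.
suff -> : C * (e / (4 * C * C * N) * (2 * C * N * `|y - x|) +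
   e / (2 * C) * `|y - x|) = e * `|y - x| by [].
by field; rewrite !gt_eqF.
Unshelve. all: by end_near. Qed.

End gradient_rules.

(** * The algebra of bounded functions *)

Section linf_algebra.
Context {R : realType} {T : Type}.
Implicit Types f g h : linf R T.

Lemma linf_le f t : `|f t| <= `|f|.
Proof. exact: le_linf_norm. Qed.

Lemma linf_ge f (M : R) : 0 <= M -> (forall t, `|f t| <= M) -> `|f| <= M.
Proof. exact: linf_norm_le. Qed.

Lemma linf_mul_bounded f g : (fun t => f t * g t) \in bounded_pred.
Proof.
apply/bounded_predP; exists (`|f| * `|g|) => t.
by rewrite normrM ler_pM// linf_le.
Qed.

Definition linf_mul f g : linf R T := Linf (linf_mul_bounded f g).

Lemma linf_mul_le f g : `|linf_mul f g| <= `|f| * `|g|.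
Proof.
by apply: linf_ge => [|t]; rewrite ?mulr_ge0//= normrM ler_pM// linf_le.
Qed.

Lemma linf_add_at f g t : (f + g) t = f t + g t. Proof. by []. Qed.
Lemma linf_opp_at f t : (- f) t = - f t. Proof. by []. Qed.
Lemma linf_scale_at (k : R) f t : (k *: f) t = k * f t. Proof. by []. Qed.
Lemma linf_mul_at f g t : linf_mul f g t = f t * g t. Proof. by []. Qed.
Lemma linf_zero_at t : (0 : linf R T) t = 0. Proof. by []. Qed.

Definition linf_at :=
  (linf_add_at, linf_opp_at, linf_scale_at, linf_mul_at, linf_zero_at).

End linf_algebra.

Infix "**" := linf_mul (at level 40, left associativity) : ring_scope.

Lemma has_grad_mul {R : realType} {T : Type} (f g : R * R -> linf R T) x
    u v u' v' : has_grad f x u v -> has_grad g x u' v' ->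
  has_grad (fun y => f y ** g y) x (u ** g x + f x ** u') (v ** g x + f x ** v').
Proof.
move=> fx gx e e0.
pose G := `|g x| + 1; pose F := `|f x| + 1; pose N := `|u| + `|v| + 1.
have G0 : 0 < G by rewrite ltr_wpDl.
have F0 : 0 < F by rewrite ltr_wpDl.
have N0 : 0 < N by rewrite ltr_wpDl// addr_ge0.
near=> y.
have fy : `|f y - f x - ((y.1 - x.1) *: u + (y.2 - x.2) *: v)|
    <= e / (3 * G) * `|y - x|.
  by near: y; apply: fx; rewrite divr_gt0// mulr_gt0.
have gy : `|g y - g x - ((y.1 - x.1) *: u' + (y.2 - x.2) *: v')|
    <= e / (3 * F) * `|y - x|.
  by near: y; apply: gx; rewrite divr_gt0// mulr_gt0.
have fy' : `|f y - f x| <= N * `|y - x|.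
  by near: y; exact: has_grad_lipschitz fx.
have gy' : `|g y - g x| <= e / (3 * N).
  by near: y; apply: has_grad_dist_le gx _ _; rewrite divr_gt0// mulr_gt0.
rewrite [X in `|X|](_ : _ =
  (f y - f x - ((y.1 - x.1) *: u + (y.2 - x.2) *: v)) ** g x +
  f x ** (g y - g x - ((y.1 - x.1) *: u' + (y.2 - x.2) *: v')) +
  (f y - f x) ** (g y - g x)); last first.
  by apply: linfP => t; rewrite !linf_at; ring.
have -> : e * `|y - x| = e / (3 * G) * `|y - x| * G +
    F * (e / (3 * F) * `|y - x|) + N * `|y - x| * (e / (3 * N)).
  by field; rewrite !gt_eqF.
have lG : `|g x| <= G by rewrite lerDl.
have lF : `|f x| <= F by rewrite lerDl.
rewrite (le_trans (ler_normD _ _))// lerD//; last first.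
  by rewrite (le_trans (linf_mul_le _ _))// ler_pM.
by rewrite (le_trans (ler_normD _ _))// lerD// (le_trans (linf_mul_le _ _))// ler_pM.
Unshelve. all: by end_near. Qed.

(** * The scalar nonlinearity *)

Section slope.
Context {R : realType}.
Implicit Types (m r u v z : R).

(** The divided difference of 2 s^3 - s^5 between [u] and [v]. *)
Definition slope u v :=
  2 * (u * u + u * v + v * v) -
  (u * u * u * u + u * u * u * v + u * u * v * v + u * v * v * v
   + v * v * v * v).

Lemma prod_dist_le (A B x y x' y' e f : R) : `|x| <= A -> `|y'| <= B ->
  `|x - x'| <= e -> `|y - y'| <= f -> `|x * y - x' * y'| <= A * f + B * e.
Proof.
move=> xA yB xe yf.
have -> : x * y - x' * y' = x * (y - y') + y' * (x - x') by ring.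
by rewrite (le_trans (ler_normD _ _))// !normrM lerD// ler_pM.
Qed.

(** On the cube of radius 3, each product of two factors moves by at most 6 r
    and each product of four by at most 108 r; the coefficients of [slope] add
    these up to 2 * 3 * 6 r + 5 * 108 r = 576 r. *)
Lemma slope_near_diag u v z r : `|u| <= 3 -> `|v| <= 3 -> `|z| <= 3 ->
  `|u - z| <= r -> `|v - z| <= r -> `|slope u v - slope z z| <= 576 * r.
Proof.
move=> u3 v3 z3 uz vz.
have sq (x y : R) : `|x| <= 3 -> `|y| <= 3 -> `|x * y| <= 9.
  by move=> x3 y3; rewrite normrM (_ : 9 = 3 * 3) ?ler_pM//; ring.
have dsq (x y : R) : `|x| <= 3 -> `|x - z| <= r -> `|y - z| <= r ->
    `|x * y - z * z| <= 6 * r.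
  move=> x3 xz yz.
  rewrite (le_trans (prod_dist_le x3 z3 xz yz))//.
  by rewrite le_eqVlt; apply/orP; left; apply/eqP; ring.
have dqu (x y x' y' : R) : `|x| <= 3 -> `|y| <= 3 -> `|x'| <= 3 ->
    `|x - z| <= r -> `|y - z| <= r -> `|x' - z| <= r -> `|y' - z| <= r ->
    `|x * y * (x' * y') - z * z * (z * z)| <= 108 * r.
  move=> x3 y3 x3' xz yz xz' yz'.
  have := prod_dist_le (sq _ _ x3 y3) (sq _ _ z3 z3) (dsq _ _ x3 xz yz)
    (dsq _ _ x3' xz' yz').
  by move=> /le_trans; apply; rewrite le_eqVlt; apply/orP; left; apply/eqP; ring.
have := dsq u u u3 uz uz; have := dsq u v u3 uz vz; have := dsq v v v3 vz vz.
have := dqu u u u u u3 u3 u3 uz uz uz uz.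
have := dqu u u u v u3 u3 u3 uz uz uz vz.
have := dqu u u v v u3 u3 v3 uz uz vz vz.
have := dqu u v v v u3 v3 v3 uz vz vz vz.
have := dqu v v v v v3 v3 v3 vz vz vz vz.
rewrite /slope !mulrA !ler_norml.
move=> /andP[? ?] /andP[? ?] /andP[? ?] /andP[? ?].
move=> /andP[? ?] /andP[? ?] /andP[? ?] /andP[? ?].
by apply/andP; split; lra.
Qed.

(** With s = u^2, a nonzero root has s (2 - s) = m, that is (1 - s)^2 = 1 - m.
    Hence 0 <= s <= 2 and 2 s >= m, and the derivative of F at u is 4 s (1 - s),
    whose square 16 s^2 (1 - m) is at least 4 a^2 (1 - b). At u = 0 the
    derivative is - m. *)
Lemma root_bounds a b m u : 0 < a -> b < 1 -> a <= m -> m <= b ->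
  - m * u + 2 * u ^+ 3 - u ^+ 5 = 0 ->
  `|u| <= 2 /\ a * (1 - b) <= `|slope u u - m|.
Proof.
move=> a0 b1 am mb.
have -> : - m * u + 2 * u ^+ 3 - u ^+ 5 = u * (2 * u ^+ 2 - u ^+ 2 * u ^+ 2 - m).
  by ring.
move=> /eqP; rewrite mulf_eq0 => /orP[/eqP ->|/eqP].
  split; first by rewrite normr0.
  rewrite /slope !mulr0 !addr0 mulr0 subr0 sub0r normrN ger0_norm; last by lra.
  have : 0 <= a * b by rewrite mulr_ge0//; lra.
  by lra.
have : 0 <= u ^+ 2 := sqr_ge0 u.
have -> : slope u u = 6 * u ^+ 2 - 5 * (u ^+ 2 * u ^+ 2) by rewrite /slope; ring.
have : `|u| ^+ 2 = u ^+ 2 by rewrite -normrX ger0_norm// sqr_ge0.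
move: (u ^+ 2) => s us s0 sm; split.
  rewrite -(@ler_pXn2r _ 2) ?nnegrE// us; nra.
rewrite -(@ler_pXn2r _ 2) ?nnegrE// ?normr_ge0 ?mulr_ge0//; [|lra|lra].
rewrite -normrX ger0_norm ?sqr_ge0//.
have -> : (6 * s - 5 * (s * s) - m) ^+ 2 = 16 * s ^+ 2 * (1 - m).
  by rewrite (_ : m = 2 * s - s * s); [ring|lra].
have s2 : a ^+ 2 <= 4 * s ^+ 2.
  have : a <= 2 * s by nra.
  by nra.
rewrite exprMn.
have : (1 - b) ^+ 2 <= 1 - m by nra.
have : 0 <= (1 - b) ^+ 2 := sqr_ge0 _.
have : 0 <= a ^+ 2 := sqr_ge0 a.
move: (a ^+ 2) ((1 - b) ^+ 2) (s ^+ 2) s2 => A B S; nra.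
Qed.

End slope.

(** * A simplified Newton iteration *)

Section newton.
Context {R : realType} {T : Type}.
Local Notation E := (linf R T).
Variables (q : T -> R) (c : R).
Hypotheses (c_gt0 : 0 < c) (q_ge : forall t, c <= `|q t|).

(** Multiplication by [q] expands norms by [c], and an error of half that size
    cannot cancel the expansion. *)
Lemma expansion_of_multiplier (d e : E) :
  (forall t, `|q t * d t - e t| <= c / 2 * `|d|) -> `|d| <= 2 / c * `|e|.
Proof.
move=> qde; have : `|d| <= c^-1 * (`|e| + c / 2 * `|d|).
  apply: linf_ge => [|t].
    by rewrite mulr_ge0 ?addr_ge0// ?mulr_ge0// ?invr_ge0 ?divr_ge0// ltW.
  rewrite mulrC ler_pdivlMr//.
  apply: (@le_trans _ _ `|q t * d t|).
    by rewrite normrM mulrC ler_wpM2r.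
  rewrite -[q t * d t](subrK (e t)) addrC (le_trans (ler_normD _ _))//.
  by rewrite lerD// linf_le.
rewrite mulrDr mulrA [c^-1 * (c / 2)]mulrA mulVf ?gt_eqF// mul1r.
by rewrite [2 / c]mulrC -mulrA; lra.
Qed.

Lemma multiplier_inv_bounded : (fun t => (q t)^-1) \in bounded_pred.
Proof.
apply/bounded_predP; exists c^-1 => t; rewrite normfV lef_pV2 ?posrE//.
exact: lt_le_trans c_gt0 (q_ge t).
Qed.

Let iq : E := Linf multiplier_inv_bounded.

(** The map u |-> u - F u / q has the zeros of [F] as fixed points. It contracts
    by 1/2 because [F] is within c / 2 of multiplication by [q], and it preserves
    the ball because its first step from the centre has length at most
    rho / 2. *)
Lemma newton_zero (F : E -> E) (z : E) (rho : R) : 0 < rho ->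
  (forall u v, `|u - z| <= rho -> `|v - z| <= rho ->
     forall t, `|q t * (u - v) t - (F u - F v) t| <= c / 2 * `|u - v|) ->
  `|F z| <= c * rho / 2 ->
  exists2 u, `|u - z| <= rho & F u = 0.
Proof.
move=> rho0 Flip Fz.
have q0 t : q t != 0 by rewrite -normr_gt0 (lt_le_trans c_gt0).
have iqc t : `|iq t| <= c^-1.
  by rewrite /= normfV lef_pV2 ?posrE// (lt_le_trans c_gt0).
pose N u := u - iq ** F u; pose B := closed_ball_ (fun x : E => `|x|) z rho.
have BE u : B u = (`|u - z| <= rho) :> Prop by rewrite /B /closed_ball_ /= distrC.
have NE u v : `|u - z| <= rho -> `|v - z| <= rho -> `|N u - N v| <= 2^-1 * `|u - v|.
  move=> uz vz; apply: linf_ge => [|t]; first by rewrite mulr_ge0.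
  have -> : (N u - N v) t = iq t * (q t * (u - v) t - (F u - F v) t).
    by rewrite /N !linf_at /=; field.
  rewrite normrM (le_trans (ler_pM _ _ (iqc t) (Flip u v uz vz t)))//.
  by rewrite mulrA [c^-1 * _]mulrA mulVf ?gt_eqF// mul1r.
have NB : set_fun B B N.
  move=> u; rewrite !BE => uz.
  have zz : `|z - z| <= rho by rewrite subrr normr0 ltW.
  rewrite -(subrK (N z) (N u)) -addrA (le_trans (ler_normD _ _))//.
  rewrite [rho in leRHS]splitr lerD//.
    by rewrite (le_trans (NE _ _ uz zz))// mulrC ler_wpM2r// invr_ge0.
  rewrite addrC addKr normrN; apply: linf_ge => [|t]; first by rewrite divr_ge0// ltW.
  rewrite linf_at normrM (le_trans (ler_pM _ _ (iqc t) (linf_le _ _)))//.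
  by rewrite ler_pdivrMl// mulrA.
have Bcl : closed B.
  by rewrite /B -closed_ballE//; exact: closed_ball_closed.
have [|||u Bu uN] := @banach_fixed_point R E B (mkfun NB).
- exists (2^-1)%:nng; split => /=; first by rewrite invf_lt1// ltr1n.
  by move=> [u v] /= [] ; rewrite !BE; exact: NE.
- exact: Bcl.
- by exists z; rewrite BE subrr normr0 ltW.
exists u; first by rewrite -BE.
apply: linfP => t.
have : iq t * F u t = 0.
  have : u t = (N u) t by rewrite -[N u]uN.
  by rewrite /N !linf_at; lra.
by move=> /eqP; rewrite mulf_eq0 /= invr_eq0 (negbTE (q0 t)) => /eqP.
Qed.

End newton.

(** * Linearisation of the residual *)

Section linearisation.
Context {R : realType} {T : Type} (L : {linear linf R T -> linf R T}).
Local Notation E := (linf R T).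
Implicit Types (u v w z p : E) (x y : R * R).

Definition residual x u : E := x.1 *: L u + nonlinearity u x.2.

Definition linf_slope u v : E :=
  2 *: (u ** u + u ** v + v ** v) -
  (u ** u ** u ** u + u ** u ** u ** v + u ** u ** v ** v + u ** v ** v ** v
   + v ** v ** v ** v).

Lemma linf_slope_at u v t : linf_slope u v t = slope (u t) (v t).
Proof. by []. Qed.

(** For [p] a divided difference of F + mu id, this is the linear operator that
    takes a difference of states to the difference of their residuals; on the
    diagonal it is the linearisation of the residual. *)
Definition linop p x w : E := p ** w - x.2 *: w + x.1 *: L w.

Lemma linop_linear p x : linear (linop p x).
Proof.
move=> k v w; apply: linfP => t.
by rewrite /linop (linearP L) !linf_at; ring.
Qed.

HB.instance Definition _ p x :=
  GRing.isLinear.Build R E E _ (linop p x) (linop_linear p x).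

Lemma linop_diff p p' x w : linop p x w = linop p' x w + (p - p') ** w.
Proof. by apply: linfP => t; rewrite /linop !linf_at; ring. Qed.

Lemma nonlinearity_at u m t :
  nonlinearity u m t = - m * u t + 2 * u t ^+ 3 - u t ^+ 5.
Proof. by []. Qed.

Lemma residualB x u v :
  residual x u - residual x v = linop (linf_slope u v) x (u - v).
Proof.
apply: linfP => t; rewrite /linop (linearB L) /residual.
rewrite !linf_at nonlinearity_at /slope.
by rewrite nonlinearity_at; ring.
Qed.

End linearisation.

(** * Existence and local uniqueness of the branch *)

Section branch.
Context {R : realType} {T : Type} (L : {linear linf R T -> linf R T}).
Local Notation E := (linf R T).
Implicit Types (u v w : E) (x y : R * R).

(** [Z] is an approximate branch on the open set [O], and [q x] approximates the
    derivative of the nonlinearity along it, with a lower bound [c]. *)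
Variables (M c r : R) (O : set (R * R)) (Z : R * R -> E) (q : R * R -> T -> R).
Hypotheses (M_gt0 : 0 < M) (L_le : forall u, `|L u| <= M * `|u|).
Hypotheses (c_gt0 : 0 < c) (r_gt0 : 0 < r) (r_le1 : r <= 1)
  (rc : 576 * r <= c / 8).
Hypothesis O_open : open O.
Hypothesis d_small : forall x, O x -> `|x.1| * M <= c / 4.
Hypothesis Z_le2 : forall x, O x -> `|Z x| <= 2.
Hypothesis Z_continuous : forall x, O x -> {for x, continuous Z}.
Hypothesis q_ge : forall x, O x -> forall t, c <= `|q x t|.
Hypothesis q_slope : forall x, O x -> forall t,
  `|q x t - (slope (Z x t) (Z x t) - x.2)| <= c / 8.
Hypothesis residual_Z : forall x, O x -> `|residual L x (Z x)| <= c * r / 4.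

Lemma near_Z_le3 x u : O x -> `|u - Z x| <= r -> `|u| <= 3.
Proof.
move=> Ox uZ; rewrite -(subrK (Z x) u) (le_trans (ler_normD _ _))//.
have := Z_le2 Ox; move: uZ r_le1; lra.
Qed.

(** The budget c / 2 is split as follows: c / 8 for [q_slope], 576 r <= c / 8 for
    moving the two arguments of the slope away from [Z x], and c / 4 for the
    coupling term. *)
Lemma linop_close x u v w : O x -> `|u - Z x| <= r -> `|v - Z x| <= r ->
  forall t, `|q x t * w t - linop L (linf_slope u v) x w t| <= c / 2 * `|w|.
Proof.
move=> Ox uZ vZ t.
have at3 (f : E) : `|f| <= 3 -> `|f t| <= 3 by apply: le_trans; exact: linf_le.
have atZ (f : E) : `|f - Z x| <= r -> `|f t - Z x t| <= r.
  by apply: le_trans; exact: (linf_le (f - Z x)).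
have Z3 : `|Z x t| <= 3.
  by apply: at3; have := Z_le2 Ox; lra.
have sl := slope_near_diag (at3 _ (near_Z_le3 Ox uZ)) (at3 _ (near_Z_le3 Ox vZ))
  Z3 (atZ _ uZ) (atZ _ vZ).
have qs : `|q x t - (slope (u t) (v t) - x.2)| <= c / 4.
  move: sl (q_slope Ox t) rc; rewrite !ler_norml => /andP[? ?] /andP[? ?] ?.
  by apply/andP; split; lra.
have -> : q x t * w t - linop L (linf_slope u v) x w t =
    (q x t - (slope (u t) (v t) - x.2)) * w t - x.1 * L w t.
  by rewrite /linop !linf_at /slope; ring.
have w1 : `|(q x t - (slope (u t) (v t) - x.2)) * w t| <= c / 4 * `|w|.
  by rewrite normrM ler_pM// linf_le.
have w2 : `|x.1 * L w t| <= c / 4 * `|w|.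
  rewrite normrM (@le_trans _ _ (`|x.1| * (M * `|w|)))//.
    by rewrite ler_wpM2l// (le_trans (linf_le _ _)).
  by rewrite mulrA ler_wpM2r// d_small.
by rewrite (le_trans (ler_normB _ _))//; lra.
Qed.

Lemma linop_expands x u v w : O x -> `|u - Z x| <= r -> `|v - Z x| <= r ->
  `|w| <= 2 / c * `|linop L (linf_slope u v) x w|.
Proof.
move=> Ox uZ vZ; apply: (expansion_of_multiplier c_gt0 (q_ge Ox)).
exact: linop_close.
Qed.

Lemma linop_surjective x u v f : O x -> `|u - Z x| <= r -> `|v - Z x| <= r ->
  exists w, linop L (linf_slope u v) x w = f.
Proof.
move=> Ox uZ vZ; pose rho := 2 / c * (`|f| + 1).
have [|w w' _ _ t||w _ /subr0_eq] := @newton_zero R T _ c c_gt0 (q_ge Ox)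
  (fun w => linop L (linf_slope u v) x w - f) 0 rho.
- by rewrite mulr_gt0 ?divr_gt0// ltr_wpDl.
- have -> : linop L (linf_slope u v) x w - f - (linop L (linf_slope u v) x w' - f)
      = linop L (linf_slope u v) x (w - w').
    by rewrite (linearB (linop L (linf_slope u v) x)) opprB addrA subrK.
  exact: linop_close.
- have -> : c * rho / 2 = `|f| + 1 by rewrite /rho; field; rewrite gt_eqF.
  by rewrite (linear0 (linop L (linf_slope u v) x)) sub0r normrN lerDl.
by exists w.
Qed.

Lemma residual_inj x u v : O x -> `|u - Z x| <= r -> `|v - Z x| <= r ->
  residual L x u = 0 -> residual L x v = 0 -> u = v.
Proof.
move=> Ox uZ vZ u0 v0; apply/subr0_eq/eqP; rewrite -normr_le0.
by rewrite (le_trans (linop_expands _ Ox uZ vZ))// -residualB u0 v0 subrr normr0 mulr0.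
Qed.

Lemma residual_zero x : O x ->
  exists2 u, `|u - Z x| <= r / 2 & residual L x u = 0.
Proof.
move=> Ox; apply: (newton_zero c_gt0 (q_ge Ox)); first by rewrite divr_gt0.
  have r2 : r / 2 <= r by move: r_gt0; lra.
  move=> u v uZ vZ t; rewrite residualB; apply: linop_close => //.
    exact: le_trans r2.
  exact: le_trans r2.
by rewrite (le_trans (residual_Z Ox))//; lra.
Qed.

(** * Smoothness of the branch *)

Variable U : R * R -> E.
Hypothesis U_near : forall x, O x -> `|U x - Z x| <= r / 2.
Hypothesis U_zero : forall x, O x -> residual L x (U x) = 0.

Let U_in_ball x : O x -> `|U x - Z x| <= r.
Proof. by move=> Ox; have := U_near Ox; have := r_gt0; lra. Qed.

Lemma residual_shift x y u : residual L y u =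
  residual L x u + ((y.1 - x.1) *: L u - (y.2 - x.2) *: u).
Proof.
by apply: linfP => t; rewrite /residual !linf_at !nonlinearity_at; ring.
Qed.

Lemma branch_increment x y : O x -> O y ->
  linop L (linf_slope (U y) (U x)) x (U y - U x) =
  (y.2 - x.2) *: U y - (y.1 - x.1) *: L (U y).
Proof.
move=> Ox Oy; rewrite -residualB (U_zero Ox) subr0.
have := residual_shift x y (U y); rewrite (U_zero Oy) => /esym/eqP.
by rewrite addr_eq0 opprB => /eqP.
Qed.

Lemma near_O x : O x -> \forall y \near x, O y.
Proof. by move=> Ox; exact: open_nbhs_nbhs. Qed.

(** [Z] is continuous, so [U y] still lies in the ball around [Z x] for [y] near
    [x]. There the operator of [branch_increment] is bounded below, and the
    right-hand side of that identity is small. *)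
Lemma branch_continuous x : O x ->
  forall e, 0 < e -> \forall y \near x, `|U y - U x| <= e.
Proof.
move=> Ox e e0; pose N := 2 / c * (3 * (1 + M)).
have N0 : 0 < N by rewrite !mulr_gt0// ?invr_gt0// addr_gt0.
near=> y.
have Oy : O y by near: y; exact: near_O.
have Zy : `|Z x - Z y| <= r / 2.
  by near: y; apply: cvgr_dist_le; [exact: Z_continuous|rewrite divr_gt0].
have yx : `|y - x| <= e / N by near: y; apply: near_dist_le; rewrite divr_gt0.
have UyZ : `|U y - Z x| <= r.
  rewrite -(subrK (Z y) (U y)) -addrA (le_trans (ler_normD _ _))//.
  by rewrite [r]splitr lerD ?U_near// distrC.
rewrite (le_trans (linop_expands _ Ox UyZ (U_in_ball Ox)))// branch_increment//.
have Uy3 := near_Z_le3 Ox UyZ.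
rewrite (@le_trans _ _ (N * `|y - x|))//; last first.
  by rewrite mulrC -ler_pdivlMr.
rewrite /N -[X in _ <= X]mulrA ler_wpM2l ?divr_ge0 ?(ltW c_gt0)//.
rewrite (le_trans (ler_normB _ _))// !normrZ.
rewrite (_ : 3 * (1 + M) * `|y - x| = `|y - x| * 3 + `|y - x| * (M * 3)); last by ring.
rewrite lerD// ler_pM ?normr_snd ?normr_fst//.
by rewrite (le_trans (L_le _))// ler_wpM2l// ltW.
Unshelve. all: by end_near. Qed.

Let P x : E := linf_slope (U x) (U x).

(** The maps produced by differentiating the branch repeatedly. Inversion of the
    linearised operator is given as a relation on [O] only, so that no inverse
    operator has to be defined or differentiated. *)
Inductive branch_alg : (R * R -> E) -> Prop :=
| alg_branch : branch_alg U
| alg_add f g : branch_alg f -> branch_alg g -> branch_alg (fun x => f x + g x)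
| alg_scale (k : R) f : branch_alg f -> branch_alg (fun x => k *: f x)
| alg_mul f g : branch_alg f -> branch_alg g -> branch_alg (fun x => f x ** g x)
| alg_op f : branch_alg f -> branch_alg (fun x => L (f x))
| alg_solve f (w : R * R -> E) : branch_alg f ->
    (forall x, O x -> linop L (P x) x (w x) = f x) -> branch_alg w.

Definition grad_in_alg f := exists f1 f2,
  [/\ branch_alg f1, branch_alg f2 & forall x, O x -> has_grad f x (f1 x) (f2 x)].

Lemma alg_inverse f : branch_alg f ->
  exists2 w : R * R -> E, branch_alg w & forall x, O x -> linop L (P x) x (w x) = f x.
Proof.
move=> tf.
have /choice[w wP] x : exists w, O x -> linop L (P x) x w = f x.
  have [Ox|nOx] := pselect (O x); last by exists 0 => /nOx.
  have [w wx] := linop_surjective (f x) Ox (U_in_ball Ox) (U_in_ball Ox).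
  by exists w.
by exists w => //; exact: alg_solve tf wP.
Qed.

(** Differentiating residual x (U x) = 0 gives A U_d = - L U and A U_mu = U for
    the linearised operator [A]. The remainder consists of the change of [x] and
    of the divided difference, each times the increment of [U]. *)
Lemma grad_branch : grad_in_alg U.
Proof.
have [w1 tw1 w1P] := alg_inverse (alg_scale (-1) (alg_op alg_branch)).
have [w2 tw2 w2P] := alg_inverse alg_branch.
exists w1, w2; split => // x Ox.
have UZ := U_in_ball Ox.
pose A := [the {linear E -> E} of linop L (P x) x].
apply: (@has_grad_implicit _ _ A (2 / c)
  (fun y => y.1 *: (- L (U x)) + y.2 *: U x)).
- by rewrite divr_gt0.
- by move=> u; exact: linop_expands.
- rewrite /A /= w1P// w2P// scaleN1r; exact: has_grad_comb2.
move=> e e0.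
have e576 : 0 < e / 3 / 576 by rewrite divr_gt0 ?ltr0n ?divr_gt0.
near=> y.
have Oy : O y by near: y; exact: near_O.
have yx : `|y - x| <= e / 3 / (1 + M).
  by near: y; apply: near_dist_le; rewrite !divr_gt0// addr_gt0.
have Uyx : `|U y - U x| <= e / 3 / 576.
  by near: y; exact: branch_continuous.
have Uyx1 : `|U y - U x| <= r / 2.
  by near: y; apply: branch_continuous => //; rewrite !divr_gt0.
set d := U y - U x.
have -> : A d - (y.1 *: (- L (U x)) + y.2 *: U x -
     (x.1 *: (- L (U x)) + x.2 *: U x)) =
  (P x - linf_slope (U y) (U x)) ** d +
  ((y.2 - x.2) *: d - (y.1 - x.1) *: L d).
  rewrite [A d](linop_diff L (P x) (linf_slope (U y) (U x))).
  rewrite branch_increment// /d (linearB L); apply: linfP => t.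
  by rewrite !linf_at; ring.
have UyZ : `|U y - Z x| <= r.
  rewrite -(subrK (U x) (U y)) -addrA (le_trans (ler_normD _ _))//.
  by rewrite [r]splitr lerD ?U_near.
have PS : `|P x - linf_slope (U y) (U x)| <= e / 3.
  apply: linf_ge => [|t]; first by rewrite divr_ge0// ltW.
  have at3 (f : E) : `|f| <= 3 -> `|f t| <= 3 by apply: le_trans; exact: linf_le.
  have Ux3 := at3 _ (near_Z_le3 Ox UZ).
  have Uy3 := at3 _ (near_Z_le3 Ox UyZ).
  have -> : (P x - linf_slope (U y) (U x)) t =
      slope (U x t) (U x t) - slope (U y t) (U x t) by [].
  rewrite distrC.
  have dt : `|U y t - U x t| <= e / 3 / 576.
    exact: le_trans (linf_le (U y - U x) t) Uyx.
  have d0 : `|U x t - U x t| <= e / 3 / 576.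
    by rewrite subrr normr0 ltW.
  have := slope_near_diag Uy3 Ux3 Ux3 dt d0; lra.
rewrite (le_trans (ler_normD _ _))//.
have -> : e * `|d| = e / 3 * `|d| + (e / 3 / (1 + M) * `|d| + e / 3 / (1 + M) * (M * `|d|))
  + e / 3 * `|d|.
  by field; rewrite gt_eqF// addr_gt0.
rewrite -[leLHS]addr0 lerD ?mulr_ge0 ?divr_ge0 ?(ltW e0)//.
rewrite lerD//; first by rewrite (le_trans (linf_mul_le _ _))// ler_wpM2r.
rewrite (le_trans (ler_normB _ _))// !normrZ lerD// ler_pM//.
- exact: le_trans (normr_snd _ _) yx.
- exact: le_trans (normr_fst _ _) yx.
Unshelve. all: by end_near. Qed.

Lemma grad_add f g : grad_in_alg f -> grad_in_alg g ->
  grad_in_alg (fun x => f x + g x).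
Proof.
move=> [f1 [f2 [tf1 tf2 fP]]] [g1 [g2 [tg1 tg2 gP]]].
exists (fun x => f1 x + g1 x), (fun x => f2 x + g2 x).
split; [exact: alg_add|exact: alg_add|move=> x Ox].
by apply: has_grad_add; [exact: fP|exact: gP].
Qed.

Lemma grad_scale (k : R) f : grad_in_alg f -> grad_in_alg (fun x => k *: f x).
Proof.
move=> [f1 [f2 [tf1 tf2 fP]]].
exists (fun x => k *: f1 x), (fun x => k *: f2 x).
split; [exact: alg_scale|exact: alg_scale|move=> x Ox].
apply: has_grad_scale; exact: fP.
Qed.

Lemma grad_mul f g : branch_alg f -> branch_alg g -> grad_in_alg f -> grad_in_alg g ->
  grad_in_alg (fun x => f x ** g x).
Proof.
move=> tf tg [f1 [f2 [tf1 tf2 fP]]] [g1 [g2 [tg1 tg2 gP]]].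
exists (fun x => f1 x ** g x + f x ** g1 x), (fun x => f2 x ** g x + f x ** g2 x).
split; [by apply: alg_add; exact: alg_mul..|move=> x Ox].
by apply: has_grad_mul; [exact: fP|exact: gP].
Qed.

Lemma grad_op f : grad_in_alg f -> grad_in_alg (fun x => L (f x)).
Proof.
move=> [f1 [f2 [tf1 tf2 fP]]].
exists (fun x => L (f1 x)), (fun x => L (f2 x)).
split; [exact: alg_op|exact: alg_op|move=> x Ox].
by apply: has_grad_linear M_gt0 L_le _; exact: fP.
Qed.

(** On the diagonal the slope is 6 U^2 - 5 U^4. *)
Lemma grad_slope : grad_in_alg P.
Proof.
have U2 : branch_alg (fun x => U x ** U x) by apply: alg_mul; exact: alg_branch.
have dU2 : grad_in_alg (fun x => U x ** U x).
  by apply: grad_mul; [exact: alg_branch..|exact: grad_branch|exact: grad_branch].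
have := grad_add (grad_scale 6 dU2) (grad_scale (-5) (grad_mul U2 U2 dU2 dU2)).
congr grad_in_alg; apply/funext => x; apply: linfP => t.
by rewrite /P linf_slope_at !linf_at /slope; ring.
Qed.

(** Differentiating A w = f gives A w' = f' - A' w. The map [k] below keeps [w]
    frozen at [x] in A w, so that its gradient is exactly this right-hand side;
    what is left, (A(y) - A(x)) (w y - w x), is small relative to the increment
    of [w]. *)
Lemma grad_solve f (w : R * R -> E) : grad_in_alg f -> branch_alg w ->
  (forall x, O x -> linop L (P x) x (w x) = f x) -> grad_in_alg w.
Proof.
move=> [f1 [f2 [tf1 tf2 fP]]] tw wP.
have [P1 [P2 [tP1 tP2 PP]]] := grad_slope.
have [w1 tw1 w1P] := alg_inverse (alg_add tf1
  (alg_scale (-1) (alg_add (alg_mul tP1 tw) (alg_op tw)))).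
have [w2 tw2 w2P] := alg_inverse (alg_add tf2
  (alg_add (alg_scale (-1) (alg_mul tP2 tw)) tw)).
exists w1, w2; split => // x Ox.
have UZ := U_in_ball Ox.
pose A := [the {linear E -> E} of linop L (P x) x].
apply: (@has_grad_implicit _ _ A (2 / c)
  (fun y => f y + (-1 *: (P y ** w x) + (y.1 *: (- L (w x)) + y.2 *: w x)))).
- by rewrite divr_gt0.
- by move=> u; exact: linop_expands.
- have := has_grad_add (fP x Ox) (has_grad_add (has_grad_scale (-1)
    (has_grad_mul (PP x Ox) (has_grad_cst (w x) x)))
    (has_grad_comb2 (- L (w x)) (w x) x)).
  have -> : A (w1 x) = f1 x + -1 *: (P1 x ** w x + L (w x)) := w1P x Ox.
  have -> : A (w2 x) = f2 x + (-1 *: (P2 x ** w x) + w x) := w2P x Ox.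
  have cst0 : P x ** 0 = 0 by apply: linfP => t; rewrite linf_mul_at mulr0.
  by rewrite cst0 !addr0 !scaleN1r opprD.
move=> e e0.
near=> y.
have Oy : O y by near: y; exact: near_O.
have yx : `|y - x| <= e / 2 / (1 + M).
  by near: y; apply: near_dist_le; rewrite !divr_gt0// addr_gt0.
have Pyx : `|P y - P x| <= e / 2.
  by near: y; apply: has_grad_dist_le (PP x Ox) _ _; rewrite divr_gt0.
set d := w y - w x.
rewrite (_ : A d - _ = (y.2 - x.2) *: d - (y.1 - x.1) *: L d - (P y - P x) ** d);
  last first.
  rewrite -(wP y Oy) -(wP x Ox) /d /A /= /linop (linearB L).
  by apply: linfP => t; rewrite !linf_at; ring.
rewrite (le_trans (ler_normB _ _))//.
have -> : e * `|d| = (e / 2 / (1 + M) * `|d| + e / 2 / (1 + M) * (M * `|d|))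
  + e / 2 * `|d|.
  by field; rewrite gt_eqF// addr_gt0.
rewrite lerD//; last by rewrite (le_trans (linf_mul_le _ _))// ler_wpM2r.
rewrite (le_trans (ler_normB _ _))// !normrZ lerD// ler_pM//.
- exact: le_trans (normr_snd _ _) yx.
- exact: le_trans (normr_fst _ _) yx.
Unshelve. all: by end_near. Qed.

Lemma alg_grad f : branch_alg f -> grad_in_alg f.
Proof.
elim => {f} [|f g _ df _ dg|k f _ df|f g tf df tg dg|f _ df|f w tf df wP].
- exact: grad_branch.
- exact: grad_add.
- exact: grad_scale.
- exact: grad_mul.
- exact: grad_op.
- exact: grad_solve df (alg_solve tf wP) wP.
Qed.

Lemma alg_iter_derive vs f : branch_alg f ->
  exists2 g, branch_alg g & forall x, O x -> iter_derive vs f x = g x.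
Proof.
move=> tf; elim: vs => [|v vs [g tg gE]] /=; first by exists f.
have [g1 [g2 [tg1 tg2 gP]]] := alg_grad tg.
exists (fun x => v.1 *: g1 x + v.2 *: g2 x).
  by apply: alg_add; exact: alg_scale.
move=> x Ox; rewrite -(has_grad_derive v (gP x Ox)).
apply: near_eq_derive; near=> y; apply: gE; near: y; exact: near_O.
Unshelve. all: by end_near. Qed.

Lemma alg_smooth f : branch_alg f -> smooth_on_open O f.
Proof.
move=> tf vs x Ox; have [g tg gE] := alg_iter_derive vs tf.
have [g1 [g2 [tg1 tg2 gP]]] := alg_grad tg.
apply: has_grad_differentiable; apply: near_eq_has_grad (gP x Ox).
near=> y; rewrite gE//; near: y; exact: near_O.
Unshelve. all: by end_near. Qed.

Lemma branch_smooth : smooth_on_open O U.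
Proof. exact: alg_smooth alg_branch. Qed.

End branch.

(** * Stationary solutions, clamping and continuation *)

Lemma stationary_solutionP {R : realType} {V : normedModType R}
  (G : V -> V) (x : V) : stationary_solution G x <-> G x = 0.
Proof.
split=> [/(_ 0) [_ <-]|Gx t]; first exact: derive_cst.
by rewrite /= Gx; exact: is_derive_cst.
Qed.

Lemma smooth_on_continuous {R : realType} {V W : normedModType R} (A : set V)
    (f : V -> W) : smooth_on A f ->
  exists2 g : V -> W, (forall x, A x -> {for x, continuous g}) &
    forall x, A x -> g x = f x.
Proof.
move=> [N [g [_ AO gs gf]]]; exists g => // x xA.
by apply: differentiable_continuous; apply: (gs [::]); exact: AO.
Qed.

Section clamp.
Context {R : realType}.
Variables a b : R.
Hypothesis le_ab : a <= b.

Definition clamp m : R := Num.max a (Num.min b m).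

Lemma clamp_in m : a <= clamp m <= b.
Proof. by rewrite /clamp le_max lexx ge_max le_ab ge_min lexx. Qed.

Lemma clamp_id m : a <= m <= b -> clamp m = m.
Proof. by move=> /andP[am mb]; rewrite /clamp (min_idPr mb) (max_idPr am). Qed.

Lemma clamp_dist m e : a - e < m < b + e -> 0 <= e -> `|m - clamp m| <= e.
Proof.
move=> /andP[am mb] e0; rewrite /clamp ler_norml.
have := le_ab; case: (leP b m) => bm; rewrite ?(max_idPr le_ab);
  last case: (leP a m) => am'; by move=> ab; apply/andP; split; lra.
Qed.

Lemma clamp_lipschitz m n : `|clamp m - clamp n| <= `|m - n|.
Proof.
have : m - n <= `|m - n| by exact: ler_norm.
have : n - m <= `|m - n| by rewrite distrC ler_norm.
move: `|m - n| => e nm mn.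
rewrite /clamp ler_norml.
have := le_ab; case: (leP b m) => bm; case: (leP b n) => bn;
  rewrite ?(max_idPr le_ab); try case: (leP a m) => am; try case: (leP a n) => an;
  by move=> ab; apply/andP; split; lra.
Qed.

Lemma clamp_continuous : continuous clamp.
Proof.
move=> m; apply/cvgrPdist_le => e e0; near=> n.
by rewrite (le_trans (clamp_lipschitz _ _))//; near: n; apply: cvgr_dist_le.
Unshelve. all: by end_near. Qed.

End clamp.

(** By the intermediate value theorem, a continuous quantity that starts at or
    below [l] and never takes a value in the gap (l, h] along the segment from 0
    to [d] stays at or below [l]. *)
Lemma trapped_along_segment {R : realType} (f : R -> R) (d l h : R) :
  l < h -> (forall s, 0 <= s <= 1 -> {for s * d, continuous f}) ->
  f 0 <= l -> (forall s, 0 <= s <= 1 -> f (s * d) <= h -> f (s * d) <= l) ->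
  f d <= l.
Proof.
move=> lh fc f0 flh; rewrite leNgt; apply/negP => fd.
pose v := Num.min (f d) h.
have fdc : {within `[0, 1], continuous (fun s => f (s * d))}.
  apply: continuous_in_subspaceT => s; rewrite inE /= in_itv /= => s01.
  by apply: continuous_comp; [exact: mulrr_continuous|exact: fc].
have vf : Num.min (f (0 * d)) (f (1 * d)) <= v <= Num.max (f (0 * d)) (f (1 * d)).
  rewrite mul0r mul1r ge_min le_max [v <= f d]ge_min lexx orbT andbT.
  by rewrite le_min (le_trans f0 (ltW fd)) (le_trans f0 (ltW lh)).
have [s] := IVT ler01 fdc vf; rewrite in_itv /= => s01 fs.
have : f (s * d) <= l by apply: flh; rewrite ?fs// /v ge_min lexx orbT.
by rewrite fs leNgt lt_min fd lh.
Qed.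

(** * The persistence theorem *)

Theorem lemma1p1 (R : realType) (n : nat) (Lambda : set 'rV[R]_n)
    (Lambda_discrete : forall x, Lambda x -> isolated Lambda x)
    (L : {linear linf R Lambda -> linf R Lambda})
    (L_bounded : bounded_near L (nbhs (0 : linf R Lambda)))
    (a b : R) (a_gt0 : 0 < a) (le_ab : a <= b) (b_lt1 : b < 1)
    (Ustar : R -> linf R Lambda)
    (Ustar_smooth : smooth_on `[a, b] Ustar)
    (Ustar_zero : forall mu, mu \in `[a, b] -> nonlinearity (Ustar mu) mu = 0) :
  exists2 d0 : R, 0 < d0 &
    let is_branch (U : R * R -> linf R Lambda) :=
      [/\ smooth_on (`]- d0, d0[ `*` `[a, b]) U,
          forall d mu, d \in `]- d0, d0[ -> mu \in `[a, b] ->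
            stationary_solution
              (fun W => d *: L W + nonlinearity W mu) (U (d, mu))
        & forall mu, mu \in `[a, b] -> U (0, mu) = Ustar mu] in
    exists2 Ut, is_branch Ut &
      forall V, is_branch V ->
        forall d mu, d \in `]- d0, d0[ -> mu \in `[a, b] ->
          V (d, mu) = Ut (d, mu).
Proof.
have [M M_gt0 L_le] : exists2 M : R, 0 < M & forall u, `|L u| <= M * `|u|.
  by have /linear_boundedP/pinfty_ex_gt0[M M0 LM] := L_bounded; exists M.
have ab0 : 0 <= a * b by rewrite mulr_ge0//; lra.
pose c := a * (1 - b).
have c_gt0 : 0 < c by rewrite mulr_gt0//; lra.
have c_le1 : c <= 1 by rewrite /c; lra.
(* The radius of the uniqueness balls; [eta] and [d0] below are then chosen so
   that the residual of the centre, at most 4 * eta, is within c r / 4. *)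
have [r r_gt0 rc] : exists2 r : R, 0 < r & 576 * r <= c / 8.
  have n0 : 0 < 576 :> R by rewrite ltr0n.
  have c8 : 0 < c / 8 by rewrite divr_gt0.
  exists (c / 8 / 576); first exact: divr_gt0.
  by rewrite mulrC divfK ?gt_eqF.
have r_le1 : r <= 1 by lra.
pose eta := c * r / 16.
have eta_gt0 : 0 < eta by rewrite /eta divr_gt0// mulr_gt0.
have cr : c * r <= c by rewrite ler_piMr// ltW.
have eta_le : eta <= c / 16 by rewrite /eta; lra.
pose d0 := eta / M.
have d0_gt0 : 0 < d0 by rewrite /d0 divr_gt0.
pose p := clamp a b.
have p_itv m : p m \in `[a, b] by rewrite in_itv /=; exact: clamp_in.
pose Z (x : R * R) := Ustar (p x.2).
pose q (x : R * R) t := slope (Z x t) (Z x t) - p x.2.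
pose O := [set x : R * R | (x.1 \in `]- d0, d0[) /\ (x.2 \in `]a - eta, b + eta[)].
have O_open : open O.
  have -> : O = (fst @^-1` `]- d0, d0[%classic) `&`
      (snd @^-1` `]a - eta, b + eta[%classic).
    by [].
  apply: openI; apply: open_comp; try exact: itv_open; move=> x _.
    exact: cvg_fst.
  exact: cvg_snd.
have dM x : O x -> `|x.1| * M <= eta.
  move=> [+ _]; rewrite in_itv /= -ltr_norml => /ltW.
  by rewrite /d0 ler_pdivlMr.
have pm x : O x -> `|x.2 - p x.2| <= eta.
  by move=> [_]; rewrite in_itv /= => x2; apply: clamp_dist => //; exact: ltW.
have root m t : m \in `[a, b] ->
    `|Ustar m t| <= 2 /\ c <= `|slope (Ustar m t) (Ustar m t) - m|.
  move=> mab; have := Ustar_zero m mab; move: mab; rewrite in_itv /= => /andP[am mb] Um.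
  by apply: (root_bounds a_gt0 b_lt1 am mb); rewrite -nonlinearity_at Um.
have Z_le2 x : `|Z x| <= 2.
  by apply: linf_ge => // t; have [] := root _ t (p_itv x.2).
have q_ge x t : c <= `|q x t| by have [] := root _ t (p_itv x.2).
have Z_continuous : continuous Z.
  have [g gc gU] := smooth_on_continuous Ustar_smooth.
  have -> : Z = g \o (p \o snd).
    by apply/funext => x; rewrite /= gU//; exact: p_itv.
  move=> x; apply: continuous_comp; last by apply: gc; exact: p_itv.
  by apply: continuous_comp; [exact: cvg_snd|exact: clamp_continuous].
have q_slope x : O x -> forall t, `|q x t - (slope (Z x t) (Z x t) - x.2)| <= c / 8.
  move=> Ox t; have -> : q x t - (slope (Z x t) (Z x t) - x.2) = x.2 - p x.2.
    by rewrite /q; ring.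
  by rewrite (le_trans (pm x Ox))// (le_trans eta_le)//; lra.
(* F(U*(p), p) = 0 for p = clamp mu, so only the shift of mu and d L remain. *)
have residual_Z x : O x -> `|residual L x (Z x)| <= c * r / 4.
  move=> Ox; have -> : residual L x (Z x) = x.1 *: L (Z x) - (x.2 - p x.2) *: Z x.
    rewrite -[RHS]addr0 -(Ustar_zero _ (p_itv x.2)); apply: linfP => t.
    by rewrite /residual /Z !linf_at !nonlinearity_at; ring.
  rewrite (le_trans (ler_normB _ _))// !normrZ.
  have -> : c * r / 4 = eta * 2 + eta * 2 by rewrite /eta; field.
  rewrite lerD//; last by rewrite ler_pM// pm.
  apply: (@le_trans _ _ (`|x.1| * (M * 2))).
    by rewrite ler_wpM2l// (le_trans (L_le _))// ler_wpM2l// ltW.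
  by rewrite mulrA ler_wpM2r// dM.
have d_small x : O x -> `|x.1| * M <= c / 4.
  by move=> /dM /le_trans; apply; rewrite (le_trans eta_le)//; lra.
have Zc x (_ : O x) := Z_continuous x.
have Z2 x (_ : O x) := Z_le2 x.
have qc x (_ : O x) := q_ge x.
have /choice[U UP] x : exists u, O x -> `|u - Z x| <= r / 2 /\ residual L x u = 0.
  have [Ox|nOx] := pselect (O x); last by exists 0 => /nOx.
  have [u uZ u0] := residual_zero L_le c_gt0 r_gt0 r_le1 rc d_small Z2 qc
    q_slope residual_Z Ox.
  by exists u.
have inO d mu : d \in `]- d0, d0[ -> mu \in `[a, b] -> O (d, mu).
  move=> dd; rewrite in_itv /= => /andP[am mb]; split => //=.
  by rewrite in_itv /=; apply/andP; split; lra.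
have ZE d mu : mu \in `[a, b] -> Z (d, mu) = Ustar mu.
  by rewrite in_itv /Z /= => ?; rewrite /p clamp_id.
have uniq x u v := @residual_inj R Lambda L M c r O Z q L_le c_gt0 r_le1 rc d_small
  Z2 qc q_slope x u v.
have d00 : 0 \in `]- d0, d0[ by rewrite in_itv /= oppr_lt0 d0_gt0.
exists d0 => // is_branch; exists U.
  split.
  - exists O, U; split => //; first by move=> [d mu] [/= ? ?]; exact: inO.
    apply: (branch_smooth M_gt0 L_le c_gt0 r_gt0 r_le1 rc O_open d_small Z2 Zc
      qc q_slope); first by move=> x /UP[].
    by move=> x /UP[].
  - move=> d mu dd mm; apply/stationary_solutionP.
    by have [] := UP (d, mu) (inO _ _ dd mm).
  - move=> mu mm; have O0 := inO _ _ d00 mm.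
    have [UZ U0] := UP _ O0; apply: (uniq _ _ _ O0) => //.
    + by rewrite (le_trans UZ)//; lra.
    + by rewrite ZE// subrr normr0 ltW.
    + by rewrite /residual scale0r add0r Ustar_zero.
move=> V [Vs V_stat V0] d mu dd mm.
have VP s : s \in `]- d0, d0[ -> residual L (s, mu) (V (s, mu)) = 0.
  move=> ss.
  apply/(stationary_solutionP (fun W => s *: L W + nonlinearity W mu)).
  exact: V_stat.
have near_center_eq s : s \in `]- d0, d0[ ->
    `|V (s, mu) - Ustar mu| <= r -> V (s, mu) = U (s, mu).
  move=> ss Vr; have Ox := inO _ _ ss mm; have [UZ U0] := UP _ Ox.
  apply: (uniq _ _ _ Ox) => //; rewrite ?ZE//; last exact: VP.
  by rewrite -(ZE s mu mm) (le_trans UZ)//; lra.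
apply: (near_center_eq) => //.
have [g gc gV] := smooth_on_continuous Vs.
have segment s : 0 <= s <= 1 -> s * d \in `]- d0, d0[.
  move=> /andP[s0 s1]; move: dd; rewrite !in_itv /= -!ltr_norml normrM (ger0_norm s0).
  by apply: le_lt_trans; rewrite ler_piMl.
have gE s : s \in `]- d0, d0[ -> g (s, mu) = V (s, mu) by move=> ss; apply: gV; split.
have half : r / 2 < r by lra.
suff : `|g (d, mu) - Ustar mu| <= r / 2 by rewrite gE// => /le_trans; apply; exact: ltW.
apply: (@trapped_along_segment R (fun s => `|g (s, mu) - Ustar mu|) d _ _ half).
- move=> s s01; have ss := segment s s01.
  apply: (@continuous_comp _ _ _ (fun s => g (s, mu) - Ustar mu) Num.norm);
    last exact: norm_continuous.
  apply: cvgB; last exact: cvg_cst.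
  apply: (@continuous_comp _ _ _ (fun s => (s, mu)) g); last by apply: gc; split.
  exact: (cvg_pair (F := nbhs (s * d)) (G := nbhs (s * d)) cvg_id (cvg_cst mu)).
- by rewrite gE// V0// subrr normr0 divr_ge0// ltW.
move=> s s01; have ss := segment s s01; rewrite gE// => /(near_center_eq _ ss) ->.
by rewrite -(ZE s mu mm); have [] := UP _ (inO _ _ ss mm).
Qed.
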